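(* For each $k\in\mathbb{N}$, the augmented chain complex $E^{(k)}_\bullet$ is acyclic. Consequently, $E_\bullet$ is acyclic.
   Context: Here $\mathbb{N}$ includes $0$, $\mathbb{F}_2=\{0,1\}$ is the field with two elements (''bits'') with addition $\oplus$, $(-)^m$ denotes $(-1)^m$, and $\mathbb{Z}B$ is the free abelian group on a set $B$. Noncrossing partitions. A partition of degree $n$ is a partition $\{\pi_1,\dots,\pi_k\}$ of $\{1,\dots,n\}$ into non-empty blocks; it is noncrossing if for all $i,j$, all $a,a'\in\pi_i$, $b,b'\in\pi_j$, $a<b<a'<b'$ implies $i=j$. The empty partition $\{\}$ is the only partition of degree $0$. For $i,m\in\mathbb{N}$ let $\mathsf{s}_i^m\colon\mathbb{N}\to\mathbb{N}$ send $x\mapsto x$ if $x<i$ and $x\mapsto x+m$ if $x\ge i$. For noncrossing partitions $p=\{\pi_1,\dots,\pi_k\}$ of degree $n$, $q=\{\rho_1,\dots,\rho_\ell\}$ of degree $m$, and $i\in\{1,\dots,n+1\}$, set $p\circ_i q=\{\mathsf{s}_i^m(\pi_1),\dots,\mathsf{s}_i^m(\pi_k),\mathsf{s}_1^{i-1}(\rho_1),\dots,\mathsf{s}_1^{i-1}(\rho_\ell)\}$, a noncrossing partition of degree $n+m$. Polarised noncrossing partitions. A polarised noncrossing partition of degree $n$ is a pair $(p,b_1\cdots b_{n+1})$ (also written $(p,b_\bullet)$) of a noncrossing partition $p$ of degree $n$ and a string of $n+1$ bits; their set is $\mathrm{NCP}_{\mathbb{F}_2}(n)$. For $(p,b_\bullet)$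 of degree $n$, $(q,c_\bullet)$ of degree $m$, $i\in\{1,\dots,n+1\}$, set $(p,b_\bullet)\circ_i(q,c_\bullet)=(p\circ_i q,\ b_1\cdots b_{i-1}(b_i\oplus c_1)\cdots(b_i\oplus c_{m+1})b_{i+1}\cdots b_{n+1})$. For $b\in\{0,1\}$ let $\psi_0^b=(\{\},b)$, and for $n>0$ let $\psi_n^b=(\{\{1,\dots,n\}\},b0\cdots0)$. Rightmost decomposition. Every polarised noncrossing partition has a unique factorisation of the form $(\dots((\psi_0^0\circ_{i_1}\psi_{m_1}^{c_1})\circ_{i_2}\psi_{m_2}^{c_2})\dots)\circ_{i_k}\psi_{m_k}^{c_k}$ with $k\ge0$, $i_1<\dots<i_k$, and, for each $j$, $m_j>0$ or $c_j=1$; it is called its rightmost decomposition and $k$ its length. Those of length at most $1$ are exactly the $\psi_m^c$. The augmented chain complex $E_\bullet$. An augmented chain complex is a chain complex of abelian groups in non-negative degrees with differential $\mathrm{d}$ together with a homomorphism $\mathrm{e}$ from degree $0$ to $\mathbb{Z}$ such that $\mathrm{e}\mathrm{d}=0$. It is acyclic if its homology vanishes in positive degrees and $\mathrm{e}$ induces an isomorphism from its degree-$0$ homology to $\mathbb{Z}$ (equivalently, the sequence extended by $\mathrm{e}$ to $\mathbb{Z}$ and then to $0$ is exact). Put $E_0=\mathbb{Z}\{s,t\}$, $E_{n+1}=\mathbb{Z}(\mathrm{NCP}_{\mathbb{F}_2}(n))$ for $n\in\mathbb{N}$, $\mathrm{e}s=\mathrm{e}t=1$. Define $\mathrm{d}$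 on generators by induction on the length of the rightmost decomposition, extending $-\circ_i-$ bilinearly where necessary: $\mathrm{d}\psi_0^c=(-)^c(t-s)$; $\mathrm{d}\psi_{m+1}^c=\psi_m^{c\oplus1}+(-)^m\psi_m^c$. If the rightmost decomposition is $(p',b'_\bullet)\circ_i\psi_m^c$ with $\psi_m^c$ its final factor and $p'$ of degree $k>0$, then: - if $i=k+1$: $\mathrm{d}((p',b'_\bullet)\circ_i\psi_0^1)=-\mathrm{d}(p',b'_\bullet)$ and $\mathrm{d}((p',b'_\bullet)\circ_i\psi_{m+1}^c)=(p',b'_\bullet)\circ_i\mathrm{d}\psi_{m+1}^c$; - if $i<k+1$: $\mathrm{d}((p',b'_\bullet)\circ_i\psi_0^1)=\mathrm{d}(p',b'_\bullet)\circ_i\psi_0^1$ and $\mathrm{d}((p',b'_\bullet)\circ_i\psi_{m+1}^c)=\mathrm{d}(p',b'_\bullet)\circ_i\psi_{m+1}^c+(-)^{k+1-i}(p',b'_\bullet)\circ_i\mathrm{d}\psi_{m+1}^c$. This is a well-defined augmented chain complex. Levels. The level $\ell_{\mathrm{NCP}}(p)$ of a noncrossing partition $p$ of degree $n$ is $0$ if $n=0$, and otherwise the maximum over the blocks $\pi$ of $p$ of $\min\pi$. The level of a bit string is $\ell_{\mathrm{B}}(b_1\cdots b_n)=\max(\{i\mid b_i=1\}\cup\{0\})$. The level of a polarised noncrossing partition is $\ell(p,b_\bullet)=\max\{\ell_{\mathrm{NCP}}(p),\ell_{\mathrm{B}}(b_\bullet)\}$. For $k\in\mathbb{N}$ let $E^{(k)}_0=E_0$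 and $E^{(k)}_{n+1}=\mathbb{Z}\{(p,b_\bullet)\in\mathrm{NCP}_{\mathbb{F}_2}(n)\mid\ell(p,b_\bullet)\le k\}$ for $n\in\mathbb{N}$; this determines a subcomplex $E^{(k)}_\bullet$ of $E_\bullet$, with the restricted differential and augmentation. *)

(* Defs.v *)
From HB Require Import structures.
From mathcomp Require Import all_boot all_order all_algebra.
From mathcomp Require Import finmap freeg.
From mathcomp Require Import zify.

Set Implicit Arguments.
Unset Strict Implicit.
Unset Printing Implicit Defensive.

Import GRing.Theory.

Local Open Scope fset_scope.
Local Open Scope nat_scope.

Definition noncrossing (p : {fset {fset nat}}) : bool :=
  [forall A : p, forall B : p, forall a : val A, forall a' : val A,
   forall b : val B, forall b' : val B,
   [&& val a < val b, val b < val a' & val a' < val b'] ==> (val A == val B)].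

Lemma noncrossingP (p : {fset {fset nat}}) :
  reflect (forall A B : {fset nat}, A \in p -> B \in p ->
           forall a a' b b', a \in A -> a' \in A -> b \in B -> b' \in B ->
           a < b -> b < a' -> a' < b' -> A = B)
          (noncrossing p).
Proof.
apply: (iffP idP) => [H A B Ap Bp a a' b b' aA a'A bB b'B h1 h2 h3|H].
  apply/eqP.
  move/forallP/(_ [` Ap])/forallP/(_ [` Bp])/forallP/(_ [` aA]): H.
  move/forallP/(_ [` a'A])/forallP/(_ [` bB])/forallP/(_ [` b'B])/implyP.
  by apply; rewrite /= h1 h2 h3.
apply/forallP => A; apply/forallP => B; apply/forallP => a; apply/forallP => a'.
apply/forallP => b; apply/forallP => b'; apply/implyP => /and3P[h1 h2 h3].
by apply/eqP/(H _ _ (valP A) (valP B) _ _ _ _ (valP a) (valP a') (valP b) (valP b')).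
Qed.

Definition is_ncp (n : nat) (p : {fset {fset nat}}) : bool :=
  [&& fset0 \notin p, fcover p == [fset x in iota 1 n], trivIfset p
    & noncrossing p].

Lemma is_ncpP (n : nat) (p : {fset {fset nat}}) :
  reflect
    [/\ forall A, A \in p -> exists x, x \in A,
        forall x, (exists2 A, A \in p & x \in A) <-> 0 < x <= n,
        forall A B x, A \in p -> B \in p -> x \in A -> x \in B -> A = B &
        noncrossing p]
    (is_ncp n p).
Proof.
have covP x : (x \in fcover p) <-> (exists2 A, A \in p & x \in A).
  split; first by case/bigfcupP => A /andP[Ap _] xA; exists A.
  by case=> A Ap xA; apply/bigfcupP; exists A; rewrite ?Ap.
have rngP x : (x \in [fset x in iota 1 n]) = (0 < x <= n).
  by rewrite inE /= mem_iota add1n ltnS.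
apply: (iffP and4P) => [] [h0 h1 h2 h3]; split => //.
- move=> A Ap; case: (fset_0Vmem A) => [A0|[x xA]]; last by exists x.
  by move: h0; rewrite -A0 Ap.
- by move=> x; rewrite -covP (eqP h1) rngP.
- move=> A B x Ap Bp xA xB; apply/eqP; apply: contraT => nAB.
  move/trivIfsetP: h2 => /(_ A B Ap Bp nAB) /fdisjointP /(_ _ xA).
  by rewrite xB.
- by apply/negP => /h0[x]; rewrite inE.
- apply/eqP/fsetP => x; rewrite rngP; apply/idP/idP; first by move/covP/h1.
  by move/h1/covP.
- apply/trivIfsetP => A B Ap Bp nAB; apply/fdisjointP => x xA.
  by apply/negP => xB; move: nAB; rewrite (h2 A B x) ?eqxx.
Qed.

Record ncp (n : nat) :=
  Ncp { blocks :> {fset {fset nat}}; ncp_blocks : is_ncp n blocks }.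

HB.instance Definition _ n := [isSub for @blocks n].
HB.instance Definition _ n := [Choice of ncp n by <:].

Definition s_ (i m x : nat) : nat := if x < i then x else x + m.

(* Here i is the 1-based index of the mathematical notation. *)
Definition comp_blocks (m i : nat) (p q : {fset {fset nat}}) :
    {fset {fset nat}} :=
  [fset s_ i m @` A | A : {fset nat} in p] `|`
  [fset s_ 1 i.-1 @` B | B : {fset nat} in q].

Lemma s_inj i m : injective (s_ i m).
Proof. by move=> x y; rewrite /s_; do 2 case: ifP; lia. Qed.

Lemma s_lt i m x y : (s_ i m x < s_ i m y) = (x < y).
Proof. by rewrite /s_; do 2 case: ifP; lia. Qed.

Lemma s_gap i m x : (s_ i m x < i) || (i + m <= s_ i m x).
Proof. by rewrite /s_; case: ifP; lia. Qed.

Lemma s1_range i m x : 0 < i -> 0 < x <= m -> i <= s_ 1 i.-1 x < i + m.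
Proof. by rewrite /s_; case: ifP; lia. Qed.

Lemma comp_blocksP (m i : nat) (p q : {fset {fset nat}}) (C : {fset nat}) :
  reflect ((exists2 A, A \in p & C = s_ i m @` A) \/
           (exists2 B, B \in q & C = s_ 1 i.-1 @` B))
          (C \in comp_blocks m i p q).
Proof.
by rewrite in_fsetU; apply: (iffP orP) => -[] h; [left|right|left|right];
   move: h; move/imfsetP.
Qed.

Lemma comp_is_ncp n m i p q : 0 < i <= n.+1 -> is_ncp n p -> is_ncp m q ->
  is_ncp (n + m) (comp_blocks m i p q).
Proof.
move=> hi; have /andP[i0 _] := hi; move=> /is_ncpP[p0 p1 p2 p3] /is_ncpP[q0 q1 q2 q3].
have pr A x : A \in p -> x \in A -> 0 < x <= n.
  by move=> Ap xA; apply/p1; exists A.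
have qr A x : A \in q -> x \in A -> 0 < x <= m.
  by move=> Ap xA; apply/q1; exists A.
have sp A y : A \in p -> y \in s_ i m @` A ->
    exists2 x, x \in A & y = s_ i m x /\ 0 < x <= n.
  by move=> Ap /imfsetP[x /= xA ->]; exists x => //; split=> //; apply: pr Ap _.
have sq A y : A \in q -> y \in s_ 1 i.-1 @` A ->
    exists2 x, x \in A & y = s_ 1 i.-1 x /\ 0 < x <= m.
  by move=> Ap /imfsetP[x /= xA ->]; exists x => //; split=> //; apply: qr Ap _.
apply/is_ncpP; split.
- by move=> C /comp_blocksP[] [A]; [move/p0|move/q0] => -[x xA] ->;
    [exists (s_ i m x)|exists (s_ 1 i.-1 x)]; apply: in_imfset.
- move=> y; split.
    by case=> C /comp_blocksP[] [A Ap ->]; [move/(sp _ _ Ap)|move/(sq _ _ Ap)];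
      case=> x _ []; rewrite /s_; case: ifP; lia.
  move=> hy; case: (boolP (i <= y < i + m)) => hy'.
    case: (q1 (y - i.-1)) => _ [|A Aq xA]; first by lia.
    exists (s_ 1 i.-1 @` A); first by apply/comp_blocksP; right; exists A.
    by apply/imfsetP; exists (y - i.-1) => //; rewrite /s_; case: ifP; lia.
  case: (p1 (if y < i then y else y - m)) => _ [|A Aq xA].
    by case: ifP; lia.
  exists (s_ i m @` A); first by apply/comp_blocksP; left; exists A.
  apply/imfsetP; eexists; first exact: xA.
  by rewrite /s_; case: (ltnP y i) => ?; case: ifP; lia.
- move=> C D y /comp_blocksP[] [A Ap ->] /comp_blocksP[] [B Bp ->].
  + case/(sp _ _ Ap) => x xA [-> _] /(sp _ _ Bp)[x' xB] [/s_inj exx' _].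
    by rewrite (p2 A B x) // exx'.
  + case/(sp _ _ Ap) => x xA [-> _] /(sq _ _ Bp)[x' xB] [+ hx'].
    move: (s_gap i m x) => /[swap] -> /=.
    by move: (s1_range i0 hx'); clear; lia.
  + case/(sq _ _ Ap) => x xA [-> hx] /(sp _ _ Bp)[x' xB] [+ _].
    move: (s_gap i m x') => /[swap] <- /=.
    by move: (s1_range i0 hx); clear; lia.
  + case/(sq _ _ Ap) => x xA [-> _] /(sq _ _ Bp)[x' xB] [/s_inj exx' _].
    by rewrite (q2 A B x) // exx'.
- apply/noncrossingP => C D /comp_blocksP[] [A Ap ->] /comp_blocksP[] [B Bp ->]
    a a' b b'.
  + case/(sp _ _ Ap) => x xA [-> _] /(sp _ _ Ap)[x' x'A] [-> _].
    case/(sp _ _ Bp) => z zB [-> _] /(sp _ _ Bp)[z' z'B] [-> _] h1 h2 h3.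
    move/noncrossingP: p3 => /(_ A B Ap Bp x x' z z' xA x'A zB z'B) -> //.
    * by rewrite s_lt in h1.
    * by rewrite s_lt in h2.
    * by rewrite s_lt in h3.
  + case/(sp _ _ Ap) => x _ [-> _] /(sp _ _ Ap)[x' _] [-> _].
    case/(sq _ _ Bp) => z _ [-> hz] /(sq _ _ Bp)[z' _] [-> hz'].
    move: (s_gap i m x') (s1_range i0 hz) (s1_range i0 hz').
    by clear; lia.
  + case/(sq _ _ Ap) => x _ [-> hx] /(sq _ _ Ap)[x' _] [-> hx'].
    case/(sp _ _ Bp) => z _ [-> _] /(sp _ _ Bp)[z' _] [-> _].
    move: (s_gap i m z) (s1_range i0 hx) (s1_range i0 hx').
    by clear; lia.
  + case/(sq _ _ Ap) => x xA [-> _] /(sq _ _ Ap)[x' x'A] [-> _].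
    case/(sq _ _ Bp) => z zB [-> _] /(sq _ _ Bp)[z' z'B] [-> _] h1 h2 h3.
    move/noncrossingP: q3 => /(_ A B Ap Bp x x' z z' xA x'A zB z'B) -> //.
    * by rewrite s_lt in h1.
    * by rewrite s_lt in h2.
    * by rewrite s_lt in h3.
Qed.

(* From here on composition indices are 0-based: [i : 'I_n.+1] stands for the
   mathematical index i + 1 in {1, ..., n + 1}. *)
Lemma pos_bounds n (i : 'I_n.+1) : 0 < i.+1 <= n.+1.
Proof. exact: ltn_ord. Qed.

Definition ncp_comp n m (p : ncp n) (i : 'I_n.+1) (q : ncp m) : ncp (n + m) :=
  Ncp (comp_is_ncp (pos_bounds i) (ncp_blocks p) (ncp_blocks q)).

Definition pncp (n : nat) : choiceType := (ncp n * n.+1.-tuple bool)%type.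

Definition comp_bits (i : nat) (b c : seq bool) : seq bool :=
  take i b ++ [seq nth false b i (+) x | x <- c] ++ drop i.+1 b.

Lemma comp_bits_size n m (i : 'I_n.+1) (b : n.+1.-tuple bool)
    (c : m.+1.-tuple bool) : size (comp_bits i b c) == (n + m).+1.
Proof.
rewrite /comp_bits !size_cat size_map size_drop size_takel !size_tuple.
  by have := ltn_ord i; lia.
by rewrite ltnW.
Qed.

Definition pcomp n m (x : pncp n) (i : 'I_n.+1) (y : pncp m) : pncp (n + m) :=
  (ncp_comp x.1 i y.1, Tuple (comp_bits_size i x.2 y.2)).

Definition psi_blocks (m : nat) : {fset {fset nat}} :=
  if m is 0 then fset0 else [fset [fset x in iota 1 m]].

Lemma psi_is_ncp m : is_ncp m (psi_blocks m).
Proof.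
have rngP x : (x \in [fset x in iota 1 m]) = (0 < x <= m).
  by rewrite inE /= mem_iota add1n ltnS.
rewrite /psi_blocks; case: m rngP => [|m] rngP; apply/is_ncpP; split.
- by move=> A; rewrite inE.
- by move=> x; split=> [[A]|]; [rewrite inE | lia].
- by move=> A B x; rewrite inE.
- by apply/noncrossingP => A B; rewrite inE.
- by move=> A /fset1P ->; exists 1; rewrite rngP.
- move=> x; rewrite -rngP; split=> [[A /fset1P ->]//|xA].
  by eexists; last exact: xA; apply/fset1P.
- by move=> A B x /fset1P -> /fset1P ->.
- by apply/noncrossingP => A B /fset1P -> /fset1P ->.
Qed.

Definition psi (m : nat) (c : bool) : pncp m :=
  (Ncp (psi_is_ncp m), [tuple of c :: nseq m false]).

(* [(i, m, c)] stands for "o_(i+1) psi_m^c"; a factorisation is listed with its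
   last factor first, the initial psi_0^0 being left implicit. *)
Definition factor : Type := nat * nat * bool.

Fixpoint degree (l : seq factor) : nat :=
  if l is (i, m, c) :: l' then degree l' + m else 0.

(* [inord] is exact whenever [i <= degree l'], as [is_rightmost] requires. *)
Fixpoint eval (l : seq factor) : pncp (degree l) :=
  if l is (i, m, c) :: l' then pcomp (eval l') (inord i) (psi m c)
  else psi 0 false.

Fixpoint is_rightmost (l : seq factor) : bool :=
  if l is (i, m, c) :: l' then
    [&& i <= degree l', (0 < m) || c,
        (if l' is (j, _, _) :: _ then j < i else true) & is_rightmost l']
  else true.

Definition is_rdecomp n (x : pncp n) (l : seq factor) : bool :=
  is_rightmost l && (Tagged pncp (eval l) == Tagged pncp x).

Lemma pncp_tagged_eq n n' (x : pncp n) (y : pncp n') : n = n' ->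
  x.1 = y.1 :> {fset {fset nat}} -> x.2 = y.2 :> seq bool ->
  Tagged pncp x = Tagged pncp y.
Proof.
move=> e; case: _ / e y => y h1 h2; congr (Tagged _ _).
by case: x y h1 h2 => [p b] [q c] /= h1 h2; congr (_, _); apply/val_inj.
Qed.

(* A down-closed set of integers above r is an interval. *)
Lemma interval_block (B : {fset nat}) r n :
    (forall b, b \in B -> r < b <= n) ->
    (forall x b, b \in B -> r < x <= b -> x \in B) ->
  exists m, B = [fset x in iota r.+1 m].
Proof.
move=> hB; elim: n hB => [|n IH] hB hcl.
  exists 0; apply/fsetP => x; rewrite !inE /=; apply/negP => /hB; lia.
case: (boolP (n.+1 \in B)) => nB.
  exists (n.+1 - r); apply/fsetP => x; rewrite inE /= mem_iota.
  apply/idP/idP; first by move/hB; lia.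
  by move=> hx; apply: (hcl _ _ nB); have := hB _ nB; lia.
apply: IH => // b bB; have := hB _ bB.
case: (eqVneq b n.+1) => [e|]; last by lia.
by move: nB; rewrite -e bB.
Qed.

Definition below (r : nat) (p : {fset {fset nat}}) (b : seq bool) : Prop :=
  (forall A, A \in p -> exists2 a, a \in A & a <= r) /\
  (forall j, r <= j -> nth false b j = false).

Definition unshift (r m x : nat) : nat := if x <= r then x else x - m.

Lemma unshift_lt r m x y : (x <= r) || (r + m < x) -> (y <= r) || (r + m < y) ->
  (unshift r m x < unshift r m y) = (x < y).
Proof. by rewrite /unshift; do 2 case: ifP; lia. Qed.

Lemma remove_is_ncp n m r p :
    is_ncp n p -> (forall x, x \in [fset x in iota r.+1 m] -> x <= n) ->
    (m = 0 \/ [fset x in iota r.+1 m] \in p) ->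
  is_ncp (n - m)
    [fset unshift r m @` A | A : {fset nat} in p `\ [fset x in iota r.+1 m]].
Proof.
set B := [fset x in _] => hp hn hm; have [p0 p1 p2 p3] := is_ncpP _ _ hp.
have BE x : (x \in B) = (r < x <= r + m) by rewrite inE /= mem_iota; lia.
have pA A x : A \in p `\ B -> x \in A ->
    [/\ A \in p, 0 < x <= n & (x <= r) || (r + m < x)].
  rewrite in_fsetD1 => /andP[nAB Ap] xA; split=> //; first by apply/p1; exists A.
  case: hm => [m0|Bp]; first by lia.
  apply/negP => h; case/eqP: nAB; apply: (p2 A B x) => //.
  by rewrite BE; move: h; lia.
have mn : m = 0 \/ r + m <= n.
  by case: (posnP m) => [|m0]; [left|right; apply: hn; rewrite BE; lia].
have uP A y : A \in p `\ B -> y \in unshift r m @` A ->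
    exists2 x, x \in A & [/\ y = unshift r m x, 0 < x <= n
                            & (x <= r) || (r + m < x)].
  move=> Ap /imfsetP[x /= xA ->]; exists x => //.
  by have [] := pA A x Ap xA.
have PB A : A \in p `\ B -> A \in p by rewrite in_fsetD1 => /andP[].
apply/is_ncpP; split.
- move=> _ /imfsetP[A /= Ap ->]; have [x xA] := p0 A (PB _ Ap).
  by exists (unshift r m x); apply: in_imfset.
- move=> y; split.
    case=> _ /imfsetP[A /= Ap ->] /(uP _ _ Ap)[x _ [->]].
    by rewrite /unshift; case: ifP; lia.
  move=> hy; case: (p1 (if y <= r then y else y + m)) => _ [|A Ap xA].
    by case: ifP; lia.
  have ApB : A \in p `\ B.
    rewrite in_fsetD1 Ap andbT; apply/eqP => AB; move: xA; rewrite AB BE.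
    by case: ifP; lia.
  exists (unshift r m @` A); first by apply/imfsetP; exists A.
  apply/imfsetP; eexists; first exact: xA.
  by rewrite /unshift; case: (leqP y r) => ?; case: ifP; lia.
- move=> _ _ y /imfsetP[A /= Ap ->] /imfsetP[C /= Cp ->].
  move=> /(uP _ _ Ap)[x xA [-> ? hx]] /(uP _ _ Cp)[z zC [e ? hz]].
  have exz : x = z by move: (unshift_lt hx hz) (unshift_lt hz hx); rewrite e; lia.
  by rewrite (p2 A C x) ?PB // exz.
- apply/noncrossingP => _ _ /imfsetP[A /= Ap ->] /imfsetP[C /= Cp ->] a a' b b'.
  case/(uP _ _ Ap) => x xA [-> _ hx] /(uP _ _ Ap)[x' x'A] [-> _ hx'].
  case/(uP _ _ Cp) => z zC [-> _ hz] /(uP _ _ Cp)[z' z'C] [-> _ hz'] h1 h2 h3.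
  move/noncrossingP: p3.
  move=> /(_ A C (PB _ Ap) (PB _ Cp) x x' z z' xA x'A zC z'C) -> //.
  + by rewrite unshift_lt in h1.
  + by rewrite unshift_lt in h2.
  + by rewrite unshift_lt in h3.
Qed.

Lemma remove_compK n m r p :
    is_ncp n p -> (m = 0 \/ [fset x in iota r.+1 m] \in p) ->
  comp_blocks m r.+1
    [fset unshift r m @` A | A : {fset nat} in p `\ [fset x in iota r.+1 m]]
    (psi_blocks m) = p.
Proof.
set B := [fset x in _] => hp hm; have [p0 p1 p2 p3] := is_ncpP _ _ hp.
have BE x : (x \in B) = (r < x <= r + m) by rewrite inE /= mem_iota; lia.
have K A : A \in p `\ B -> s_ r.+1 m @` (unshift r m @` A) = A.
  rewrite in_fsetD1 => /andP[nAB Ap].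
  have h x : x \in A -> s_ r.+1 m (unshift r m x) = x.
    move=> xA; have : (x <= r) || (r + m < x).
      case: hm => [m0|Bp]; first by lia.
      apply/negP => h; case/eqP: nAB; apply: (p2 A B x) => //.
      by rewrite BE; move: h; lia.
    by rewrite /s_ /unshift; do 2 case: ifP; lia.
  apply/fsetP => y; apply/imfsetP/idP => [[_ /= /imfsetP[x /= xA ->] ->]|yA].
    by rewrite h.
  by exists (unshift r m y); rewrite ?h //=; apply/imfsetP; exists y.
have KB : s_ 1 r @` [fset x in iota 1 m] = B.
  apply/fsetP => y; rewrite BE; apply/imfsetP/idP => [[x /=]|hy].
    by rewrite inE /= mem_iota /s_ => hx ->; case: ifP; lia.
  exists (y - r); first by rewrite inE /= mem_iota; lia.
  by rewrite /s_; case: ifP; lia.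
apply/fsetP => C; apply/comp_blocksP/idP.
  case=> [[_ /imfsetP[A /= Ap ->] ->]|[D]].
    by rewrite K //; move: Ap; rewrite in_fsetD1 => /andP[].
  rewrite /psi_blocks; case: m @B hm KB {BE K} => [|m] B [//|Bp] KB //.
  by move=> /fset1P -> ->; rewrite KB.
move=> Cp; case: (eqVneq C B) => [CB|nCB]; [right|left].
  exists [fset x in iota 1 m]; last by rewrite CB KB.
  case: m @B hm BE CB {K KB} => [|m] B hm BE CB; last exact/fset1P.
  by have [x] := p0 C Cp; rewrite CB BE; lia.
have CpB : C \in p `\ B by rewrite in_fsetD1 nCB.
by exists (unshift r m @` C); [apply/imfsetP; exists C|rewrite K].
Qed.

Lemma rdecomp_below r n (x : pncp n) : below r x.1 x.2 ->
  exists l, is_rdecomp x l &&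
            (if l is (j, _, _) :: _ then j < r else true).
Proof.
elim: r n x => [|r IH] n [p b] [/= hA hb].
  have [p0 p1 p2 p3] := is_ncpP _ _ (ncp_blocks p).
  have pE : blocks p = fset0.
    apply/eqP; rewrite -fsubset0; apply/fsubsetP => A Ap.
    case: (hA A Ap) => a aA; have : 0 < a <= n by apply/p1; exists A.
    lia.
  have n0 : n = 0.
    case: n p b {hA hb} p0 p1 p2 p3 pE => // n p b _ p1 _ _ pE.
    by case: (p1 1) => _ [//|A]; rewrite pE inE.
  exists [::]; rewrite /is_rdecomp /= andbT; apply/eqP/pncp_tagged_eq => //=.
  have sb := size_tuple b.
  apply: (@eq_from_nth _ false) => [|j]; first by rewrite sb n0.
  by move=> hj; rewrite hb //; case: j hj => [|[]].
have hp := ncp_blocks p; have [p0 p1 p2 /noncrossingP p3] := is_ncpP _ _ hp.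
have sb := size_tuple b.
have [m hm mr] : exists2 m, m = 0 \/ [fset x in iota r.+1 m] \in blocks p &
    forall A, A \in blocks p -> A != [fset x in iota r.+1 m] ->
      exists2 a, a \in A & a <= r.
  case: (boolP [exists A : blocks p, [forall a : val A, r < val a]]); last first.
    move=> /existsPn h; exists 0; first by left.
    move=> A Ap _; have /forallPn[a] := h [` Ap].
    by rewrite -leqNgt => ar; exists (val a) => //; apply: valP.
  case/existsP => -[B Bp] /forallP /= hB.
  have {}hB c : c \in B -> r < c by move=> cB; apply: (hB [` cB]).
  have rB : r.+1 \in B.
    case: (hA B Bp) => c cB; have := hB c cB => h1 h2.
    by rewrite (_ : r.+1 = c) //; lia.
  have [m Bm] : exists m, B = [fset x in iota r.+1 m].
    apply: (@interval_block B r n) => [c cB|x c cB hx].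
      rewrite hB //=; have : 0 < c <= n by apply/p1; exists B.
      by case/andP.
    case: (eqVneq x c) => [->//|nxc]; case: (eqVneq x r.+1) => [->//|nxr].
    have hc : 0 < c <= n by apply/p1; exists B.
    case: (p1 x) => _ [|C Cp xC]; first by lia.
    suff <- : C = B by [].
    case: (hA C Cp) => d dC hd; case: (eqVneq d r.+1) => [ed|nd].
      by apply: (p2 C B d) => //; rewrite ed.
    by apply: (p3 C B Cp Bp d x r.+1 c) => //; lia.
  exists m; first by right; rewrite -Bm.
  move=> A Ap nAB; case: (hA A Ap) => a aA ha; exists a => //.
  case: (eqVneq a r.+1) => [ea|]; last by lia.
  case/eqP: nAB; rewrite -Bm; apply: (p2 A B r.+1) => //.
  by rewrite -ea.
set B := [fset x in _] in hm mr *.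
have BE x : (x \in B) = (r < x <= r + m) by rewrite inE /= mem_iota; lia.
set c := nth false b r.
case: (boolP ((0 < m) || c)) => hmc; last first.
  case: (IH n (p, b)).
    split=> /= [A Ap|j hj].
      apply: mr => //; apply/eqP => AB; have [x] := p0 A Ap.
      by rewrite AB BE; lia.
    case: (eqVneq j r) => [->|?]; last by apply: hb; lia.
    by move: hmc; rewrite negb_or => /andP[_]; rewrite /c => /negbTE.
  move=> l /andP[hl hr]; exists l; rewrite hl /=.
  by case: l hr {hl} => // -[[j ?] ?] ? /ltnW; rewrite ltnS.
have Bn x : x \in B -> x <= n.
  case: hm => [m0|Bp xB]; first by rewrite BE; lia.
  have : 0 < x <= n by apply/p1; exists B.
  by case/andP.
have rmn : r + m <= n.
  case: (posnP m) => [m0|m0].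
    move: hmc; rewrite m0 /= addn0 /c => cT.
    case: (leqP r n) => // h; move: cT; rewrite nth_default //.
    by rewrite sb.
  by apply: Bn; rewrite BE; lia.
have sz : size (take r b ++ nseq (n - m - r).+1 false) == (n - m).+1.
  by rewrite size_cat size_nseq size_take sb; case: ifP; lia.
pose x' : pncp (n - m) := (Ncp (remove_is_ncp hp Bn hm), Tuple sz).
have [|l /andP[/andP[hl /eqP lx] hr]] := IH (n - m) x'.
  split=> /= [_ /imfsetP[A /= Ap ->]|j hj].
    move: Ap; rewrite in_fsetD1 => /andP[nAB Ap].
    case: (mr A Ap nAB) => a aA ha; exists a => //.
    by apply/imfsetP; exists a => //; rewrite /unshift ha.
  rewrite nth_cat size_takel; last by rewrite sb; lia.
  rewrite ltnNge hj -[_ :: _]/(nseq (n - m - r).+1 false) /=.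
  by case: (j - r) => [//|k] /=; rewrite nth_nseq if_same.
have dl : degree l = n - m := congr1 tag lx.
have [l1 l2] : (eval l).1 = x'.1 :> {fset {fset nat}} /\
               (eval l).2 = x'.2 :> seq bool.
  have F : forall z : {k & pncp k}, z = Tagged pncp x' ->
      (tagged z).1 = x'.1 :> {fset {fset nat}} /\
      (tagged z).2 = x'.2 :> seq bool by move=> z ->.
  exact: (F _ lx).
exists ((r, m, c) :: l); rewrite /= ltnS leqnn andbT.
have rl : r <= degree l by rewrite dl; lia.
apply/andP; split; first by rewrite /= rl hmc hl /= andbT; case: l hr {hl lx dl l1 l2 rl}.
apply/eqP/pncp_tagged_eq; first by rewrite /= dl; lia.
  by rewrite /= l1 /= inordK ?ltnS // (remove_compK hp).
rewrite /= l2 /= inordK ?ltnS // /comp_bits.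
have st : size (take r b) = r by rewrite size_takel // sb; lia.
rewrite take_size_cat // drop_cat st ltnNge leqnSn /= subSnn.
rewrite nth_cat st ltnn subnn /= drop0 map_nseq.
apply: (@eq_from_nth _ false) => [|j].
  by rewrite !size_cat /= size_cat !size_nseq st sb; lia.
move=> _; rewrite nth_cat st; case: ltnP => hj; first by rewrite nth_take.
case: (eqVneq j r) => [->|njr]; first by rewrite subnn.
rewrite hb; last by lia.
case e: (j - r) => [|k] /=; first by lia.
by rewrite nth_cat size_nseq; case: ltnP => ?; rewrite nth_nseq if_same.
Qed.

Lemma rdecomp_exists n (x : pncp n) : exists l, is_rdecomp x l.
Proof.
case: (@rdecomp_below n.+1 n x) => [|l /andP[hl _]]; last by exists l.
have [p0 p1 _ _] := is_ncpP _ _ (ncp_blocks x.1); split=> [A Ap|j hj].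
  case: (p0 A Ap) => a aA; exists a => //.
  have : 0 < a <= n by apply/p1; exists A.
  by move=> ?; lia.
by rewrite nth_default // size_tuple.
Qed.

Definition head_bound (l : seq factor) : nat :=
  if l is (i, _, _) :: _ then i.+1 else 0.

Lemma is_rightmost_cons i m c l : is_rightmost ((i, m, c) :: l) ->
  [/\ i <= degree l, (0 < m) || c, head_bound l <= i & is_rightmost l].
Proof. by move=> /= /and4P[h1 h2 h3 h4]; split=> //; case: l h3 {h1 h4} => [|[[]]]. Qed.

Lemma psi_blocksP m A :
  reflect (0 < m /\ A = [fset x in iota 1 m]) (A \in psi_blocks m).
Proof.
case: m => [|m]; first by rewrite inE; constructor=> -[].
by apply: (iffP (fset1P _ _)) => [|[]].
Qed.

Lemma shift_psi r m : s_ 1 r @` [fset x in iota 1 m] = [fset x in iota r.+1 m].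
Proof.
apply/fsetP => y; apply/imfsetP/idP => [[x /=]|].
  by rewrite !inE /= !mem_iota /s_ => hx ->; case: ifP; lia.
rewrite inE /= mem_iota => hy; exists (y - r); first by rewrite inE /= mem_iota; lia.
by rewrite /s_; case: ifP; lia.
Qed.

Lemma evalE i m c l : i <= degree l ->
  (eval ((i, m, c) :: l)).1 = comp_blocks m i.+1 (eval l).1 (psi_blocks m)
    :> {fset {fset nat}} /\
  (eval ((i, m, c) :: l)).2 = comp_bits i (eval l).2 (c :: nseq m false)
    :> seq bool.
Proof. by move=> h; rewrite /= inordK ?ltnS. Qed.

Lemma nth_comp_bits n (b : seq bool) i m c j : size b = n.+1 -> i <= n ->
    (forall j, i <= j -> nth false b j = false) ->
  nth false (comp_bits i b (c :: nseq m false)) j =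
    if j < i then nth false b j else (j == i) && c.
Proof.
move=> sb hi hb; rewrite /comp_bits nth_cat size_takel; last by rewrite sb ltnW.
case: ltnP => hj; first by rewrite nth_take.
rewrite hb //= map_nseq.
case: (eqVneq j i) => [->|nji]; first by rewrite subnn.
case e: (j - i) => [|k] /=; first by lia.
rewrite nth_cat size_nseq; case: ltnP => ?; first by rewrite nth_nseq if_same.
by rewrite nth_drop hb //; lia.
Qed.

Lemma eval_below l : is_rightmost l -> below (head_bound l) (eval l).1 (eval l).2.
Proof.
elim: l => [_|[[i m] c] l IH /is_rightmost_cons[hi hmc hl /IH[hA hb]]].
  by split=> [A|[|[|j]]] //=; rewrite inE.
have hb' j : i <= j -> nth false (eval l).2 j = false by move=> ?; apply: hb; lia.
have [-> ->] := evalE m c hi; split=> [C|j hj].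
  case/comp_blocksP=> -[A].
    move=> /hA[a aA ha] ->; exists (s_ i.+1 m a); first exact: in_imfset.
    by rewrite /s_ /=; case: ifP; lia.
  case/psi_blocksP => m0 -> ->; rewrite shift_psi.
  by exists i.+1 => //; rewrite inE /= mem_iota; lia.
rewrite (nth_comp_bits _ _ _ (size_tuple _)) //.
by rewrite /= in hj; case: ltnP => ?; [lia | case: eqVneq => //; lia].
Qed.

Lemma last_block i m c l : is_rightmost ((i, m, c) :: l) -> forall x,
  (exists A, [/\ A \in blocks (eval ((i, m, c) :: l)).1, x \in A &
              forall a, a \in A -> i < a]) <-> (i < x <= i + m).
Proof.
move=> /is_rightmost_cons[hi hmc hl /eval_below[hA _]] x.
have [-> _] := evalE m c hi; split.
  case=> A [/comp_blocksP[] [B hB ->] xB h].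
    have [a aB ha] := hA B hB; have := h _ (in_imfset _ (s_ i.+1 m) aB).
    by rewrite /s_; case: ifP; lia.
  move: xB; case/psi_blocksP: hB => _ ->; rewrite shift_psi inE /= mem_iota; lia.
move=> hx; exists (s_ 1 i @` [fset x in iota 1 m]); rewrite shift_psi; split.
- apply/comp_blocksP; right; exists [fset x in iota 1 m]; rewrite ?shift_psi //.
  by apply/psi_blocksP; split=> //; lia.
- by rewrite inE /= mem_iota; lia.
- by move=> a; rewrite inE /= mem_iota; lia.
Qed.

Lemma last_bit i m c l : is_rightmost ((i, m, c) :: l) -> forall j,
  nth false (eval ((i, m, c) :: l)).2 j =
    if j < i then nth false (eval l).2 j else (j == i) && c.
Proof.
move=> /is_rightmost_cons[hi hmc hl /eval_below[_ hb]] j.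
have [_ ->] := evalE m c hi; apply: (nth_comp_bits _ _ _ (size_tuple _)) => // k ?.
by apply: hb; lia.
Qed.

Lemma below_head_bound r l : is_rightmost l ->
  below r (eval l).1 (eval l).2 -> head_bound l <= r.
Proof.
case: l => [//|[[i m] c] l] hl [hA hb] /=; rewrite ltnNge; apply/negP => hr.
have /is_rightmost_cons[_ hmc _ _] := hl.
case: c hl hA hb hmc => [|] hl hA hb hmc.
  by have := hb i hr; rewrite last_bit // ltnn eqxx.
case: (last_block hl i.+1) => _ [|A [/hA[a aA ha] _ /(_ _ aA)]]; lia.
Qed.

Lemma imfset_injective i m : injective (fun A : {fset nat} => s_ i m @` A).
Proof.
move=> A B /fsetP h; apply/fsetP => x; have := h (s_ i m x).
by rewrite !mem_imfset //; apply: s_inj.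
Qed.

Lemma eval_inj l l2 : is_rightmost l -> is_rightmost l2 ->
  (eval l).1 = (eval l2).1 :> {fset {fset nat}} ->
  (eval l).2 = (eval l2).2 :> seq bool -> l = l2.
Proof.
have key : forall k k2, is_rightmost k -> is_rightmost k2 ->
    (eval k).1 = (eval k2).1 :> {fset {fset nat}} ->
    (eval k).2 = (eval k2).2 :> seq bool -> head_bound k <= head_bound k2.
  move=> k k2 hk hk2 hp hb; apply: (below_head_bound hk).
  by rewrite hp hb; apply: eval_below.
elim: l l2 => [|[[i m] c] l IH] l2 hl hl2 hp hb.
  by have := key _ _ hl2 hl (esym hp) (esym hb); case: l2 {hl2 hp hb} => [|[[]]].
have h3 := key _ _ hl2 hl (esym hp) (esym hb).
have h4 := key _ _ hl hl2 hp hb.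
case: l2 hl2 hp hb h3 h4 => [//|[[i2 m2] c2] l2] hl2 hp hb /= h3 h4.
have e : i2 = i by lia.
subst i2; clear h3 h4.
have ec : c = c2.
  by have := congr1 (nth false ^~ i) hb; rewrite /= !last_bit // ltnn eqxx.
have em : m = m2.
  have h x : (i < x <= i + m) <-> (i < x <= i + m2).
    by apply: iff_trans (iff_sym (last_block hl x)) _; rewrite hp; apply: last_block.
  by case: (h (i + m)) (h (i + m2)); lia.
subst c2 m2; congr (_ :: _).
have /is_rightmost_cons[d1 hmc hd rl] := hl.
have /is_rightmost_cons[d2 _ hd2 rl2] := hl2.
have sz : degree l = degree l2.
  have := congr1 size hb; rewrite !size_tuple /=; lia.
apply: IH => //.
  have F l' l'' : i <= degree l' -> i <= degree l'' ->
      head_bound l' <= i -> is_rightmost l' ->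
      (eval ((i, m, c) :: l')).1 = (eval ((i, m, c) :: l'')).1
        :> {fset {fset nat}} ->
      forall A, A \in blocks (eval l').1 -> A \in blocks (eval l'').1.
    move=> e1 e2 f /eval_below[g _] E A Ap.
    have : s_ i.+1 m @` A \in blocks (eval ((i, m, c) :: l'')).1.
      rewrite -E; have [-> _] := evalE m c e1.
      by apply/comp_blocksP; left; exists A.
    have [-> _] := evalE m c e2; case/comp_blocksP => -[B hB].
      by move/imfset_injective ->.
    case/psi_blocksP: hB => _ ->; rewrite shift_psi => /fsetP h.
    have [a aA ha] := g A Ap; have := h (s_ i.+1 m a).
    rewrite mem_imfset //; last exact: s_inj.
    by rewrite aA inE /= mem_iota /s_; case: ifP; lia.
  by apply/fsetP => A; apply/idP/idP; apply: F.
apply: (@eq_from_nth _ false) => [|j _]; first by rewrite !size_tuple sz.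
case: (ltnP j i) => hj.
  by have := congr1 (nth false ^~ j) hb; rewrite /= !last_bit // hj.
have [_ g1] := eval_below rl; have [_ g2] := eval_below rl2.
by rewrite g1 ?g2 //; lia.
Qed.

Lemma rdecomp_unique n (x : pncp n) l l2 :
  is_rdecomp x l -> is_rdecomp x l2 -> l = l2.
Proof.
move=> /andP[rl /eqP hl] /andP[rl2 /eqP hl2].
have F (z : {k & pncp k}) : z = Tagged pncp x ->
    (tagged z).1 = x.1 :> {fset {fset nat}} /\ (tagged z).2 = x.2 :> seq bool.
  by move=> ->.
have [a1 a2] := F _ hl; have [b1 b2] := F _ hl2.
by apply: eval_inj => //; [rewrite a1 b1 | rewrite a2 b2].
Qed.

Definition rdecomp n (x : pncp n) : seq factor := xchoose (rdecomp_exists x).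

Lemma rdecompP n (x : pncp n) : is_rdecomp x (rdecomp x).
Proof. exact: xchooseP (rdecomp_exists x). Qed.

Local Open Scope ring_scope.

(* The two generators s and t of E_0. *)
Notation vs := false.
Notation vt := true.

Definition gen (n : nat) : choiceType :=
  if n is n'.+1 then pncp n' else bool.

Definition E (n : nat) : lmodType int := {freeg (gen n) / int}.

Definition basis n (x : gen n) : E n := << x >>.

(* The bilinear extension of composition, with a generator in one argument. *)
Definition compl n m (a : E n.+1) (i : 'I_n.+1) (y : pncp m) : E (n + m).+1 :=
  fglift (fun x : pncp n => @basis (n + m).+1 (pcomp x i y)) a.

Definition compr n m (x : pncp n) (i : 'I_n.+1) (a : E m.+1) : E (n + m).+1 :=
  fglift (fun y : pncp m => @basis (n + m).+1 (pcomp x i y)) a.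

Definition castE n n' (e : n = n') (a : E n) : E n' := ecast k (E k) e a.

Definition bdry_psi (m : nat) (c : bool) : E m :=
  if m is m'.+1 then
    @basis m'.+1 (psi m' (~~ c)) + (-1) ^+ m' *: @basis m'.+1 (psi m' c)
  else (-1) ^+ c *: (@basis 0 vt - @basis 0 vs).

(* The boundary of "x o_(i+1) psi_m^c", for a final factor of a rightmost
   decomposition with x of degree k and dx the boundary of x. When k = 0, the
   decomposition has length at most 1 and the composite is psi_m^c. The test
   [i == k] is the case of the mathematical index i + 1 = k + 1. *)
Definition bdry_step (k : nat) :
    pncp k -> E k -> forall (i m : nat) (c : bool), E (k + m) :=
  match k return pncp k -> E k -> forall (i m : nat) (c : bool), E (k + m) with
  | 0 => fun _ _ _ m c => bdry_psi m c
  | k'.+1 => fun x dx i m c =>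
    match m return E (k'.+1 + m) with
    | 0 =>
      if i == k'.+1 then castE (esym (addn0 k'.+1)) (- dx)
      else compl dx (inord i) (psi 0 true)
    | m'.+1 =>
      let r := castE (esym (addnS k'.+1 m'))
                 (compr x (inord i) (bdry_psi m'.+1 c)) in
      if i == k'.+1 then r
      else compl dx (inord i) (psi m'.+1 c) + (-1) ^+ (k'.+1 - i) *: r
    end
  end.

Fixpoint bdry_list (l : seq factor) : E (degree l) :=
  if l is (i, m, c) :: l' then bdry_step (eval l') (bdry_list l') i m c
  else bdry_psi 0 false.

Lemma degree_rdecomp n (x : pncp n) : degree (rdecomp x) = n.
Proof.
by have /andP[_ /eqP e] := rdecompP x; apply: (congr1 tag e).
Qed.

Definition bdry_gen n (x : pncp n) : E n :=
  castE (degree_rdecomp x) (bdry_list (rdecomp x)).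

Lemma bdry_gen_eval l : is_rightmost l -> bdry_gen (eval l) = bdry_list l.
Proof.
move=> hl; have e : rdecomp (eval l) = l.
  apply: rdecomp_unique (rdecompP _) _; by rewrite /is_rdecomp hl eqxx.
rewrite /bdry_gen; move: (degree_rdecomp _); rewrite e => h.
by rewrite /castE (eq_irrelevance h erefl).
Qed.

Definition bdry (n : nat) : E n.+1 -> E n :=
  fglift (fun x : pncp n => bdry_gen x).

Definition aug : E 0 -> int := fglift (fun=> 1 : int^o).

(* The blocks are nonempty subsets of {1, ..., n}, so the default n of the
   iterated minimum plays no role. *)
Definition ncp_level n (p : ncp n) : nat :=
  (\max_(A <- blocks p) \big[minn/n]_(a <- enum_fset A) a)%N.

Definition bits_level (b : seq bool) : nat :=
  (\max_(i < size b | nth false b i) i.+1)%N.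

Definition level n (x : pncp n) : nat := maxn (ncp_level x.1) (bits_level x.2).

(* E^(k)_n as a subgroup of E_n: the elements whose support consists of
   generators of level at most k (all of E_0 when n = 0). *)
Definition sublevel (k n : nat) : pred (E n) :=
  match n return pred (E n) with
  | 0 => predT
  | n'.+1 => fun a => all (fun x : pncp n' => level x <= k)%N (dom a)
  end.

(* Acyclicity of the graded subgroup S of an augmented chain complex (C, d, e),
   as exactness of ... -> S_1 -> S_0 -> Z -> 0. The right-to-left implications
   say that d maps S into S, that e d = 0 and that d d = 0 on S. *)
Definition acyclic (C : nat -> zmodType) (d : forall n, C n.+1 -> C n)
    (e : C 0%N -> int) (S : forall n, pred (C n)) : Prop :=
  [/\ forall z : int, exists2 x, S 0%N x & e x = z,
      forall x, (S 0%N x /\ e x = 0) <-> (exists2 y, S 1%N y & d 0%N y = x) &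
      forall n x, (S n.+1 x /\ d n x = 0) <->
                  (exists2 y, S n.+2 y & d n.+1 y = x)].

(* Main.v *)
Require Import Defs.
From mathcomp Require Import all_boot all_algebra.
From HB Require Import structures.
From mathcomp Require Import finmap freeg zify ring.

(** The level of a polarised noncrossing partition can be read off its
    rightmost decomposition: it is the (1-based) composition index of the last
    factor, or 0 for the empty decomposition (level_le_head_bound). So the
    complex is filtered by that index, and passing from level i to level i + 1
    (i being the 0-based index of the last factor) adds the generators
    l o_i psi_m^c, with l of level at most i.

    Modulo level i, the boundary on these new generators is that of a tensor
    product: the part of level i in degrees greater than i, tensored with the
    complex of the psi_m^c modulo psi_0^0. The psi_m^c form the periodic free
    resolution of the sign module over the group ring of F_2; psi_0^0 spans its
    homology, so the quotient is contractible, by psi_m^1 |-> psi_(m+1)^0 and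
    psi_m^0 |-> 0. This contraction gives an operator h (homotopy) with
    d h + h d = 1 - r (homotopy_formula), where r (retraction) is the identity
    on level i, sends l o_i psi_0^1 to - l and kills the other new generators.
    A cycle w of level i + 1 is thus d (h w) + r w with r w a cycle of level i,
    and by induction on the level every cycle of positive degree is a boundary
    (bd_exact). The induction starts at level 0, which is spanned by psi_0^0, s
    and t with d psi_0^0 = t - s, and this already gives exactness in degree 0
    at every level (bdry_exact0). Every chain has finite support, hence lies in
    some level, so the whole complex is acyclic as well.

    These computations take place in one free abelian group (chain), with basis
    all lists of factors together with s and t: there the degree is a property
    of a generator and not part of its type, and composing with a final factor
    is consing it to a list. The chain groups E n embed in it through rightmost
    decompositions (chain_of), compatibly with boundaries (chain_of_bdry), and
    the image of the part of level k is spanned by the cells in in_level k n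
    (sublevelE, chain_of_onto). *)

Set Implicit Arguments.
Unset Strict Implicit.
Unset Printing Implicit Defensive.

Import GRing.Theory.

Local Open Scope fset_scope.
Local Open Scope ring_scope.

(** * Linear maps out of free abelian groups *)

Section Support.

Context (K : choiceType).
Implicit Types (P Q : pred K) (w v : {freeg K / int}).

Definition supp P w : bool := all P (dom w).

Lemma suppP P w : reflect (forall x, coeff x w != 0 -> P x) (supp P w).
Proof.
by apply: (iffP allP) => h x; [rewrite -mem_dom | rewrite mem_dom]; apply: h.
Qed.

Lemma supp0 P : supp P 0.
Proof. by rewrite /supp dom0. Qed.

Lemma suppU P x : P x -> supp P << x >>.
Proof. by move=> Px; rewrite /supp domU1 /= Px. Qed.

Lemma suppD P w v : supp P w -> supp P v -> supp P (w + v).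
Proof.
move=> /suppP hw /suppP hv; apply/suppP => x; rewrite coeffD => nz.
have [w0|/hw//] := eqVneq (coeff x w) 0; apply: hv.
by move: nz; rewrite w0 add0r.
Qed.

Lemma suppZ P (a : int) w : supp P w -> supp P (a *: w).
Proof.
move=> /suppP hw; apply/suppP => x; rewrite coeffZ mulf_eq0 negb_or.
by case/andP => _ /hw.
Qed.

Lemma suppN P w : supp P w -> supp P (- w).
Proof. by move=> hw; rewrite -scaleN1r suppZ. Qed.

Lemma sub_supp P Q w : (forall x, P x -> Q x) -> supp P w -> supp Q w.
Proof. by move=> PQ; apply: sub_all. Qed.

Lemma supp_pred0 P w : (forall x, ~~ P x) -> supp P w -> w = 0.
Proof.
move=> P0 /suppP hw; apply/eqP/freeg_eqP => x; rewrite coeff0.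
by apply/eqP; apply: contraT => /hw Px; have := P0 x; rewrite Px.
Qed.

Lemma freeg_sumZ w : w = \sum_(z <- dom w) coeff z w *: << z >>.
Proof.
rewrite -{1}[w]freeg_sumE; apply: eq_bigr => z _.
by apply/eqP/freeg_eqP => x; rewrite coeffZ !coeffU mul1r.
Qed.

Lemma supp_sum P (I : eqType) (r : seq I) (F : I -> {freeg K / int}) :
  (forall i, i \in r -> supp P (F i)) -> supp P (\sum_(i <- r) F i).
Proof.
move=> h; rewrite big_seq; apply: (big_ind (supp P)) => //; first exact: supp0.
by move=> *; apply: suppD.
Qed.

Lemma linear_eq_supp (M : lmodType int) P w
    (F G : {linear {freeg K / int} -> M}) :
  (forall x, P x -> F << x >> = G << x >>) -> supp P w -> F w = G w.
Proof.
move=> FG /allP hw; rewrite [w]freeg_sumZ !linear_sum big_seq [RHS]big_seq.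
by apply: eq_bigr => x xw; rewrite !linearZ /= FG // hw.
Qed.

Lemma linear_eq (M : lmodType int) (F G : {linear {freeg K / int} -> M}) :
  (forall x, F << x >> = G << x >>) -> F =1 G.
Proof.
move=> FG w; apply: (linear_eq_supp (P := predT)).
  by move=> x _; apply: FG.
by apply/suppP.
Qed.

End Support.

Lemma linear_supp (K L : choiceType) (P : pred K) (Q : pred L) w
    (F : {linear {freeg K / int} -> {freeg L / int}}) :
  (forall x, P x -> supp Q (F << x >>)) -> supp P w -> supp Q (F w).
Proof.
move=> PQ /allP hw; rewrite [w]freeg_sumZ linear_sum; apply: supp_sum => x xw.
by rewrite linearZ /= suppZ // PQ // hw.
Qed.

Section Lift.

Context (K : choiceType) (M : lmodType int) (f : K -> M).

Lemma fglift1 x : fglift f << x >> = f x.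
Proof. by rewrite liftU scale1r. Qed.

HB.instance Definition _ :=
  GRing.isZmodMorphism.Build {freeg K / int} M (fglift f) (lift_is_additive f).

Lemma fglift_scalable : scalable (fglift f).
Proof. by move=> a w; rewrite -[a]intz !scaler_int raddfMz. Qed.

HB.instance Definition _ :=
  GRing.isScalable.Build int {freeg K / int} M _ (fglift f) fglift_scalable.

End Lift.

(* Decides identities between formal sums by comparing coefficients. *)
Ltac freeg_ring :=
  apply/eqP/freeg_eqP => ?;
  rewrite !(coeffD, coeffN, coeffZ, coeff0);
  repeat match goal with
    |- context [coeff ?x ?w] => move: (coeff x w) => ? end;
  ring.

(** * The complex spanned by factorisations *)

Definition cell : choiceType := (bool + seq factor)%type.
Definition chain : lmodType int := {freeg cell / int}.

Definition graft_cell i m c (g : cell) : cell :=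
  if g is inr l then inr (if (0 < m)%N || c then (i, m, c) :: l else l) else g.

(** Composition with the factor (i, m, c). The factor psi_0^0 is the unit of
    composition and never occurs in a rightmost decomposition, so it is
    dropped. *)
Definition graft i m c : chain -> chain :=
  fglift (fun g => << graft_cell i m c g >>).
HB.instance Definition _ i m c := GRing.Linear.on (graft i m c).

(** The chain x o_i d psi_m^c, except that it is 0 for m = 0: there d psi_0^c
    lies in degree 0, where no composition is defined. *)
Definition gface i m c : chain -> chain :=
  fglift (fun g => if m is m'.+1 then
    << graft_cell i m' (~~ c) g >> + (-1) ^+ m' *: << graft_cell i m' c g >>
    else 0).
HB.instance Definition _ i m c := GRing.Linear.on (gface i m c).

Lemma graft0 i w : graft i 0 false w = w.
Proof.
apply: (linear_eq (F := graft i 0 false) (G := idfun)) => x.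
by rewrite /= /graft fglift1; case: x.
Qed.

Lemma gface0 i c w : gface i 0 c w = 0.
Proof.
apply: (linear_eq (F := gface i 0 c) (G := \0)) => x.
by rewrite /= /gface fglift1.
Qed.

Lemma gfaceS i m c w :
  gface i m.+1 c w = graft i m (~~ c) w + (-1) ^+ m *: graft i m c w.
Proof.
apply: (linear_eq (F := gface i m.+1 c)
  (G := graft i m (~~ c) \+ (-1) ^+ m \*: graft i m c)) => x.
by rewrite /= /gface /graft !fglift1.
Qed.

(** This is d d psi_(m+1)^c = 0, composed with a chain on the left. *)
Lemma gface_gface i m c w :
  gface i m (~~ c) w + (-1) ^+ m *: gface i m c w = 0.
Proof.
case: m => [|m]; first by rewrite !gface0 scaler0 addr0.
rewrite !gfaceS negbK exprS -signr_odd.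
by case: (odd m); rewrite /= ?expr1 ?expr0; freeg_ring.
Qed.

(** One formula for all the cases of the boundary. At the last position
    (i = degree l') the sign of the second summand is 1, and for l' empty the
    case m = 0 gives d psi_0^1 = - d psi_0^0. *)
Fixpoint bd_list (l : seq factor) : chain :=
  if l is (i, m, c) :: l' then
    (if (i < degree l')%N then graft i m c (bd_list l')
     else if m == 0 then - bd_list l' else 0)
    + (-1) ^+ (degree l' - i) *: gface i m c << inr l' : cell >>
  else << inl vt : cell >> - << inl vs : cell >>.

Definition bd : chain -> chain :=
  fglift (fun g : cell => if g is inr l then bd_list l else 0).
HB.instance Definition _ := GRing.Linear.on bd.

Lemma bd1 l : bd << inr l : cell >> = bd_list l.
Proof. by rewrite /bd fglift1. Qed.

(** The generators of degree n of the subcomplex of level k. *)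
Definition in_level (k n : nat) (g : cell) : bool :=
  match g, n with
  | inl _, 0 => true
  | inr l, n'.+1 => [&& is_rightmost l, degree l == n' & (head_bound l <= k)%N]
  | _, _ => false
  end.

Lemma in_level_le k k' n g : (k <= k')%N -> in_level k n g -> in_level k' n g.
Proof.
move=> kk'; case: g n => [b|l] [|n] //= /and3P[-> -> h] /=.
exact: leq_trans kk'.
Qed.

Lemma supp_level_le k k' n (w : chain) : (k <= k')%N ->
  supp (in_level k n) w -> supp (in_level k' n) w.
Proof. by move=> kk'; apply: sub_supp => g; apply: in_level_le. Qed.

Lemma in_levelS k n (P : cell -> Prop) :
    (forall l, is_rightmost l -> degree l = n -> (head_bound l <= k)%N ->
      P (inr l)) ->
  forall g, in_level k n.+1 g -> P g.
Proof. by move=> h [b|l] //= /and3P[? /eqP ? ?]; apply: h. Qed.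

Lemma is_rightmost_consI i m c l : (i <= degree l)%N -> (0 < m)%N || c ->
  (head_bound l <= i)%N -> is_rightmost l -> is_rightmost ((i, m, c) :: l).
Proof.
move=> h1 h2 h3 h4; rewrite /= h1 h2 h4 /=.
by case: l h3 {h1 h4} => [|[[]]] *; rewrite andbT.
Qed.

Lemma supp_graft i m c n (w : chain) : (i <= n)%N ->
  supp (in_level i n.+1) w -> supp (in_level i.+1 (n + m).+1) (graft i m c w).
Proof.
move=> le_in; apply: (linear_supp (F := graft i m c)).
apply: in_levelS => l hl dl hb.
rewrite /= /graft fglift1 /=; apply: suppU.
case: ifP => hmc; rewrite /in_level.
  by rewrite is_rightmost_consI ?dl //= ltnS leqnn dl eqxx.
by case: m hmc => // _; rewrite hl dl addn0 eqxx /= ltnW.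
Qed.

Lemma supp_gface i m c n (w : chain) : (i <= n)%N ->
  supp (in_level i n.+1) w -> supp (in_level i.+1 (n + m)) (gface i m c w).
Proof.
move=> le_in hw; case: m => [|m]; first by rewrite gface0 supp0.
by rewrite gfaceS addnS suppD ?suppZ ?supp_graft.
Qed.

(** The Leibniz rule, valid for every factor including psi_0^0; this is what
    lets it be applied to the terms of d psi_1^c. *)
Lemma bd_graft i m c n (w : chain) : (i <= n)%N -> supp (in_level i n.+1) w ->
  bd (graft i m c w) =
    if (i < n)%N then graft i m c (bd w) + (-1) ^+ (n - i) *: gface i m c w
    else if m == 0 then (-1) ^+ c *: bd w else gface i m c w.
Proof.
move=> le_in.
have E l : degree l = n -> bd (graft i m c << inr l : cell >>) =
    if (i < n)%N then graft i m c (bd_list l)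
      + (-1) ^+ (n - i) *: gface i m c << inr l : cell >>
    else if m == 0 then (-1) ^+ c *: bd_list l
    else gface i m c << inr l : cell >>.
  move=> dl; rewrite {1}/graft fglift1 /=; case: ifP => hmc; rewrite bd1 /=.
    rewrite dl; case: ltnP => lt_in //.
    have -> : (n - i = 0)%N by lia.
    rewrite expr0 scale1r; case: m hmc => [|m]; last by rewrite add0r.
    by rewrite gface0 addr0 /= => ->; rewrite expr1 scaleN1r.
  case: m c hmc => [|m] [] // _.
  rewrite graft0 gface0 scaler0 addr0 expr0 scale1r.
  by case: ifP.
case: ifP E => _ E; [|move: E; case: ifP => _ E].
- apply: (linear_eq_supp (F := bd \o graft i m c)
    (G := (graft i m c \o bd) \+ ((-1) ^+ (n - i) \*: gface i m c))).
  by apply: in_levelS => l _ dl _; rewrite /= E // bd1.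
- apply: (linear_eq_supp (F := bd \o graft i m c) (G := ((-1) ^+ c \*: bd))).
  by apply: in_levelS => l _ dl _; rewrite /= E // bd1.
- apply: (linear_eq_supp (F := bd \o graft i m c) (G := gface i m c)).
  by apply: in_levelS => l _ dl _; rewrite /= E.
Qed.

Lemma bd_gface i m c n (w : chain) : (i <= n)%N -> supp (in_level i n.+1) w ->
  bd (gface i m c w) = if (i < n)%N then gface i m c (bd w) else 0.
Proof.
move=> le_in hw; case: m => [|m].
  by rewrite !gface0 raddf0; case: ifP.
rewrite !gfaceS linearD linearZ /= !(bd_graft _ _ le_in hw).
case: ifP => _; last first.
  case: eqP => [->|_]; last exact: gface_gface.
  by case: c; rewrite /= ?expr0 ?expr1; freeg_ring.
have := gface_gface i m c w; move: (gface _ _ (~~ c) w) => a.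
rewrite !scalerDr addrACA !scalerA mulrC -scalerA -scalerDr => ->.
by rewrite scaler0 addr0.
Qed.

Lemma supp_bd_list l : is_rightmost l ->
  supp (in_level (head_bound l) (degree l)) (bd_list l).
Proof.
elim: l => [_|[[i m] c] l IH /is_rightmost_cons[hi hmc hb hl]].
  by rewrite /= suppD ?suppN // suppU.
have hd := supp_level_le hb (IH hl).
have hU : supp (in_level i (degree l).+1) (<< inr l >> : chain).
  by apply: suppU; rewrite /= hl eqxx.
rewrite /=; apply: suppD; last by rewrite suppZ ?supp_gface.
case: ltnP => hi'.
  by case: (degree l) hi' hd => // n ? ?; rewrite addSn; apply: supp_graft.
case: eqP => [->|_]; last by rewrite supp0.
by rewrite addn0 suppN // (supp_level_le (leqnSn i)).
Qed.

Lemma supp_bd k n (w : chain) :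
  supp (in_level k n.+1) w -> supp (in_level k n) (bd w).
Proof.
apply: (linear_supp (F := bd)); apply: in_levelS => l hl <- hk.
by rewrite /= bd1; apply: supp_level_le hk (supp_bd_list hl).
Qed.

(** For i < degree l, the terms of d l may be composed at their last position,
    where the Leibniz rule lacks its first summand; but that summand would be
    (d d l) o_i psi_m^c = 0, so the cancellation against d (l o_i d psi_m^c) is
    the same as elsewhere. *)
Lemma bd_bd_list l : is_rightmost l -> bd (bd_list l) = 0.
Proof.
elim: l => [_|[[i m] c] l IH /is_rightmost_cons[hi hmc hb hl]].
  by rewrite /= raddfB /= /bd !fglift1 subrr.
have hd := supp_level_le hb (supp_bd_list hl).
have hU : supp (in_level i (degree l).+1) (<< inr l >> : chain).
  by apply: suppU; rewrite /= hl eqxx.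
rewrite /= linearD linearZ /= (bd_gface _ _ hi hU) bd1.
case: ltnP => hi'; last first.
  by rewrite scaler0 addr0; case: ifP; rewrite ?raddfN ?raddf0 /= ?IH ?oppr0.
move: (bd_list l) (degree l) IH hi' hd {hi hU hb} => d [//|n] IH lt_in hd.
have le_in : (i <= n)%N by [].
rewrite (bd_graft m c le_in hd) (IH hl) !linear0 subSn // exprS.
case: ifP => [_|ni].
  by rewrite add0r mulN1r scaleNr addrN.
have -> : (n - i = 0)%N by lia.
case: eqP => [->|_]; first by rewrite gface0 !scaler0 addr0.
by rewrite expr0 mulr1 scaleN1r addrN.
Qed.

Lemma bd_bd k n (w : chain) : supp (in_level k n.+1) w -> bd (bd w) = 0.
Proof.
apply: (linear_eq_supp (F := bd \o bd) (G := \0)).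
by apply: in_levelS => l hl _ _; rewrite /= bd1 bd_bd_list.
Qed.

(** * Contracting one level onto the previous one *)

(** The contraction psi_m^1 |-> psi_(m+1)^0, psi_m^0 |-> 0 on the last factor,
    with the Koszul sign of moving it past the degree l - i positions that
    follow. *)
Definition homotopy i : chain -> chain :=
  fglift (fun g : cell => if g is inr ((j, m, c) :: l) then
    if (j == i) && c then
      (-1) ^+ (degree l - i) *: << inr ((i, m.+1, false) :: l) : cell >>
    else 0 else 0).
HB.instance Definition _ i := GRing.Linear.on (homotopy i).

Definition retraction i : chain -> chain :=
  fglift (fun g : cell => if g is inr ((j, m, c) :: l) then
    if j == i then if m == 0 then - << inr l : cell >> else 0
    else << g >> else << g >>).
HB.instance Definition _ i := GRing.Linear.on (retraction i).

Lemma homotopy_lower i n w : supp (in_level i n) w -> homotopy i w = 0.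
Proof.
apply: (linear_eq_supp (F := homotopy i) (G := \0)) => -[b|l] /=.
  by rewrite /homotopy fglift1.
case: n => // n /and3P[_ _]; rewrite /homotopy fglift1.
by case: l => // -[[j m] c] l /= ji; rewrite ltn_eqF.
Qed.

Lemma retraction_lower i n w : supp (in_level i n) w -> retraction i w = w.
Proof.
apply: (linear_eq_supp (F := retraction i) (G := idfun)) => -[b|l] /=.
  by rewrite /retraction fglift1.
case: n => // n /and3P[_ _]; rewrite /retraction fglift1.
by case: l => // -[[j m] c] l /= ji; rewrite ltn_eqF.
Qed.

Lemma homotopy_graft i m c n (w : chain) : supp (in_level i n.+1) w ->
  homotopy i (graft i m c w) =
    if c then (-1) ^+ (n - i) *: graft i m.+1 false w else 0.
Proof.
case: c; last first.
  case: m => [|m]; first by rewrite graft0; apply: homotopy_lower.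
  apply: (linear_eq_supp (F := homotopy i \o graft i m.+1 false) (G := \0)).
  apply: in_levelS => l _ _ _.
  by rewrite /= /graft fglift1 /homotopy fglift1 /= eqxx.
apply: (linear_eq_supp (F := homotopy i \o graft i m true)
  (G := (-1) ^+ (n - i) \*: graft i m.+1 false)).
apply: in_levelS => l _ dl _.
by rewrite /= /graft !fglift1 /= orbT /homotopy fglift1 eqxx dl.
Qed.

Lemma homotopy_gface i m c n (w : chain) : supp (in_level i n.+1) w ->
  homotopy i (gface i m.+1 c w) =
    (-1) ^+ (c * m) *: ((-1) ^+ (n - i) *: graft i m.+1 false w).
Proof.
move=> hw; rewrite gfaceS linearD linearZ /= !(homotopy_graft _ _ hw).
by case: c; rewrite /= ?scaler0 ?addr0 ?add0r ?mul1n ?mul0n ?expr0 ?scale1r.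
Qed.

(** The correction by the retraction comes from the summand
    l o_i d psi_1^0 = l o_i psi_0^1 + l of d (l o_i psi_1^0), whose term l lies
    in the lower level; for m > 0 both terms of l o_i d psi_(m+1)^0 are new
    generators. *)
Lemma homotopy_formula i n (w : chain) : supp (in_level i.+1 n.+1) w ->
  bd (homotopy i w) + homotopy i (bd w) = w - retraction i w.
Proof.
apply: (linear_eq_supp (F := (bd \o homotopy i) \+ (homotopy i \o bd))
  (G := idfun \- retraction i)).
apply: in_levelS => l hl _ hb /=.
case: (leqP (head_bound l) i) => hi.
  have hU : supp (in_level i (degree l).+1) (<< inr l >> : chain).
    by apply: suppU; rewrite /= hl eqxx.
  rewrite (homotopy_lower hU) (homotopy_lower (supp_bd hU)).
  by rewrite (retraction_lower hU) linear0 addr0 subrr.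
case: l hl hb hi => [//|[[j m] c] l] /= hl hb hi.
have {hb hi} e : j = i by lia.
subst j; have {hl} [hi hmc hb hl] := is_rightmost_cons hl.
have hU : supp (in_level i (degree l).+1) (<< inr l >> : chain).
  by apply: suppU; rewrite /= hl eqxx.
have -> : retraction i << inr ((i, m, c) :: l) >> =
    if m == 0 then - << inr l >> else 0.
  by rewrite /retraction fglift1 eqxx.
have -> : << inr ((i, m, c) :: l) >> = graft i m c << inr l >>.
  by rewrite /graft fglift1 /= hmc.
have hv := supp_bd hU; clear n w.
move: (degree l) << inr l >> hi hU hv => n u hi hU.
rewrite (homotopy_graft _ _ hU) (bd_graft _ _ hi hU).
have hG c' : homotopy i (gface i m c' u) = if m is m'.+1 then
    (-1) ^+ (c' * m') *: ((-1) ^+ (n - i) *: graft i m false u) else 0.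
  case: (m) => [|m']; first by rewrite gface0 linear0.
  exact: homotopy_gface hU.
move bu: (bd u) => v hv; case: ltnP => lt_in.
  case: n hi hU hv lt_in hG => [//|n] hi hU hv lt_in hG.
  rewrite linearD linearZ /= hG (homotopy_graft _ _ hv) subSn // exprS.
  case: c hmc => hmc.
    rewrite linearZ /= (bd_graft _ _ hi hU) bu lt_in gfaceS subSn // exprS /=.
    rewrite -(signr_odd _ (n - i)).
    case: m hmc {hG} => [|m] hmc /=.
      rewrite graft0.
      by case: (odd (n - i)); rewrite /= ?expr1 ?expr0; freeg_ring.
    rewrite mul1n exprS -(signr_odd _ m).
    by case: (odd (n - i)); case: (odd m); rewrite /= ?expr1 ?expr0;
      freeg_ring.
  case: m hmc {hG} => [//|m] _ /=.
  rewrite linear0 mul0n expr0 -(signr_odd _ (n - i)).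
  by case: (odd (n - i)); rewrite /= ?expr1 ?expr0; freeg_ring.
have ni : (n - i = 0)%N by lia.
rewrite ni expr0 !scale1r in hG *.
case: c hmc => hmc.
  rewrite (bd_graft _ _ hi hU) bu ltnNge lt_in /= gfaceS.
  case: m hmc hG => [|m] hmc hG /=.
    rewrite linearZ /= (homotopy_lower hv).
    by rewrite graft0; freeg_ring.
  rewrite hG mul1n exprS -(signr_odd _ m).
  by case: (odd m); rewrite /= ?expr1 ?expr0 ?scale1r; freeg_ring.
case: m hmc hG => [//|m] _ hG /=.
by rewrite linear0 hG mul0n expr0; freeg_ring.
Qed.

Lemma supp_homotopy i n (w : chain) : supp (in_level i.+1 n.+1) w ->
  supp (in_level i.+1 n.+2) (homotopy i w).
Proof.
apply: (linear_supp (F := homotopy i)); apply: in_levelS => l hl dl hb.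
rewrite /= /homotopy fglift1.
case: l hl dl hb => [|[[j m] c] l]; rewrite ?supp0 //.
move=> /is_rightmost_cons[hi _ hj hl] /= dl _; case: ifP => [/andP[/eqP e _]|_].
  rewrite -e suppZ // suppU // /in_level is_rightmost_consI //=.
  by rewrite -dl addnS eqxx leqnn.
exact: supp0.
Qed.

Lemma supp_retraction i n (w : chain) : supp (in_level i.+1 n.+1) w ->
  supp (in_level i n.+1) (retraction i w).
Proof.
apply: (linear_supp (F := retraction i)); apply: in_levelS => l hl dl hb.
rewrite /= /retraction fglift1; case: l hl dl hb => [|[[j m] c] l] hl dl hb.
  by apply: suppU; rewrite /= -dl eqxx.
case: eqP => [e|/eqP ji]; last first.
  apply: suppU; rewrite /in_level hl dl eqxx /=.
  by move: hb ji => /=; lia.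
have [hi _ hj hl'] := is_rightmost_cons hl.
case: eqP => [m0|_]; last exact: supp0.
by apply/suppN/suppU; rewrite /= hl' -dl /= m0 addn0 eqxx -e.
Qed.

Lemma bd_exact k n (w : chain) : supp (in_level k n.+1) w -> bd w = 0 ->
  exists2 v : chain, supp (in_level k n.+2) v & bd v = w.
Proof.
elim: k w => [|k IH] w hw bw0.
  exists 0; first exact: supp0.
  rewrite linear0; case: n hw => [|n] hw; last first.
    apply/esym/(supp_pred0 _ hw) => -[//|] [|[[i m] c] l]; first by [].
    by rewrite /= ltn0 !andbF.
  have e : w = coeff (inr [::]) w *: << inr [::] : cell >>.
    apply/eqP/freeg_eqP => g; rewrite coeffZ coeffU mul1r.
    case: (eqVneq (inr [::] : cell) g) => [<-|ng]; first by rewrite mulr1.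
    rewrite mulr0; apply/eqP; apply: contraT => /(suppP _ _ hw).
    case: g ng => [//|] [|[[i m] c] l]; first by rewrite eqxx.
    by rewrite /= ltn0 !andbF.
  move: bw0; rewrite e linearZ /= bd1 /= => /(congr1 (coeff (inl vt : cell))).
  by rewrite coeff0 coeffZ coeffB !coeffU /= subr0 mulr1 => ->; rewrite scale0r.
have := homotopy_formula hw; rewrite bw0 linear0 addr0 => hf.
have hh := supp_homotopy hw; have hr := supp_retraction hw.
have br0 : bd (retraction k w) = 0.
  have -> : retraction k w = w - bd (homotopy k w).
    by rewrite hf opprB addrC subrK.
  by rewrite linearB /= bw0 (bd_bd hh) subrr.
have [v hv bv] := IH _ hr br0.
exists (homotopy k w + v); last by rewrite linearD /= bv hf subrK.
by rewrite suppD // (supp_level_le (leqnSn k)).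
Qed.

(** * Identification with polarised noncrossing partitions *)

(** Replaces a partition by its decomposition without transport along the
    equation between their degrees. *)
Lemma pncp_eval_ind (P : forall n, pncp n -> Prop) :
  (forall l, is_rightmost l -> P _ (eval l)) -> forall n (x : pncp n), P n x.
Proof.
move=> h n x; have /andP[hl /eqP e] := rdecompP x.
have : forall z : {n & pncp n}, z = Tagged pncp x -> P _ (tagged z) -> P n x.
  by move=> z ->.
by move/(_ _ e); apply; apply: h.
Qed.

Lemma rdecomp_eval l : is_rightmost l -> rdecomp (eval l) = l.
Proof.
by move=> hl; apply: rdecomp_unique (rdecompP _) _; rewrite /is_rdecomp hl eqxx.
Qed.

Lemma rdecomp_rightmost n (x : pncp n) : is_rightmost (rdecomp x).
Proof. by have /andP[] := rdecompP x. Qed.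

Lemma Tagged_pncp_inj n (x y : pncp n) : Tagged pncp x = Tagged pncp y -> x = y.
Proof. by move/eqP; rewrite eq_Tagged => /eqP. Qed.

Lemma rdecomp_inj n : injective (@rdecomp n).
Proof.
move=> x y e; have /andP[_ /eqP ex] := rdecompP x.
have /andP[_ /eqP ey] := rdecompP y.
by apply: Tagged_pncp_inj; rewrite -ex -ey e.
Qed.

Lemma rdecomp_tagged n n' (x : pncp n) (y : pncp n') :
  Tagged pncp x = Tagged pncp y -> rdecomp x = rdecomp y.
Proof.
move=> e; have /andP[h /eqP ex] := rdecompP x.
by apply: rdecomp_unique (rdecompP _); rewrite /is_rdecomp h ex e eqxx.
Qed.

Lemma pcomp_psi0 n (x : pncp n) (i : 'I_n.+1) :
  Tagged pncp (Defs.pcomp x i (psi 0 false)) = Tagged pncp x.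
Proof.
apply: pncp_tagged_eq; first by rewrite addn0.
  apply/fsetP => A; apply/comp_blocksP/idP => [[] [B Bp ->]|Ap].
  - suff -> : s_ i.+1 0 @` B = B by [].
    apply/fsetP => y; apply/imfsetP/idP => [[z zB ->]|yB].
      by rewrite /s_ addn0 if_same.
    by exists y => //; rewrite /s_ addn0 if_same.
  - by move: Bp; rewrite inE.
  left; exists A => //.
  apply/fsetP => y; apply/idP/imfsetP => [yB|[z zB ->]].
    by exists y => //; rewrite /s_ addn0 if_same.
  by rewrite /s_ addn0 if_same.
rewrite /= /comp_bits /= addbF -cat_rcons -take_nth ?size_tuple //.
exact: cat_take_drop.
Qed.

Lemma rdecomp_pcomp n (x : pncp n) i m c : (i <= n)%N ->
  (head_bound (rdecomp x) <= i)%N ->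
  rdecomp (Defs.pcomp x (inord i) (psi m c)) =
    if (0 < m)%N || c then (i, m, c) :: rdecomp x else rdecomp x.
Proof.
case: ifP => hmc; last first.
  by case: m c hmc => [|m] [] // _ _ _; apply/rdecomp_tagged/pcomp_psi0.
elim/pncp_eval_ind: x => l hl hi; rewrite rdecomp_eval // => hb.
apply: (@rdecomp_eval ((i, m, c) :: l)); exact: is_rightmost_consI.
Qed.

Definition cell_of n : gen n -> cell :=
  match n with 0 => fun b => inl b | n'.+1 => fun x => inr (rdecomp x) end.

Lemma cell_of_inj n : injective (@cell_of n).
Proof. by case: n => [|n] x y []; [| apply: rdecomp_inj]. Qed.

Definition chain_of n : E n -> chain := fglift (fun x => << cell_of x >>).
HB.instance Definition _ n := GRing.Linear.on (@chain_of n).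

Lemma chain_of1 n (x : gen n) : chain_of (basis x) = << cell_of x >>.
Proof. exact: fglift1. Qed.

Lemma chain_ofS n (x : pncp n) :
  @chain_of n.+1 << x >> = << inr (rdecomp x) : cell >>.
Proof. exact: (@chain_of1 n.+1). Qed.

Lemma chain_of_castE n n' (e : n = n') (a : E n) :
  chain_of (castE e a) = chain_of a.
Proof. by case: _ / e. Qed.

Lemma coeff_chain_of n (a : E n) x : coeff (cell_of x) (chain_of a) = coeff x a.
Proof.
rewrite {1}[a]freeg_sumZ linear_sum raddf_sum [in RHS](freeg_sumZ a) raddf_sum.
apply: eq_bigr => y _; rewrite linearZ /= !coeffZ (chain_of1 y) !coeffU.
by rewrite (inj_eq (@cell_of_inj n)).
Qed.

Lemma chain_of_inj n : injective (@chain_of n).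
Proof.
by move=> a b ab; apply/eqP/freeg_eqP => x; rewrite -!coeff_chain_of ab.
Qed.

Lemma supp_chain_of n (P : pred cell) (a : E n) :
  supp P (chain_of a) = supp (fun x => P (cell_of x)) a.
Proof.
apply/idP/idP => [/suppP h|].
  by apply/suppP => x nz; apply: h; rewrite coeff_chain_of.
apply: (linear_supp (F := @chain_of n)) => x Px.
by rewrite /= (chain_of1 x); apply: suppU.
Qed.

Lemma chain_of_compl n (a : E n.+1) i m c : (i <= n)%N ->
    supp (in_level i n.+1) (chain_of a) ->
  chain_of (compl a (inord i) (psi m c)) = graft i m c (chain_of a).
Proof.
move=> le_in; rewrite supp_chain_of.
apply: (linear_eq_supp (F := @chain_of (n + m).+1 \o
   fglift (fun x => basis (Defs.pcomp x (inord i) (psi m c) : gen (n + m).+1)))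
   (G := graft i m c \o @chain_of n.+1)) => x /and3P[_ _ hb].
apply: etrans (esym (congr1 (graft i m c) (chain_ofS x))).
rewrite /= fglift1 (@chain_of1 (n + m).+1) /graft fglift1 /=.
by rewrite rdecomp_pcomp.
Qed.

Lemma chain_of_compr_psi n (x : pncp n) i m c : (i <= n)%N ->
    (head_bound (rdecomp x) <= i)%N ->
  chain_of (compr x (inord i) (bdry_psi m.+1 c)) =
    gface i m.+1 c << inr (rdecomp x) : cell >>.
Proof.
move=> le_in hb; rewrite /compr /= linearD linearZ /= !fglift1.
rewrite linearD linearZ /= !chain_of1 gfaceS /graft !fglift1 /=.
by rewrite !rdecomp_pcomp.
Qed.

(** A composite of length 1 is psi_m^c itself, which reconciles the separate
    clause for psi_m^c with the general step. *)
Lemma psi_pcomp m c : psi m c = Defs.pcomp (psi 0 false) (inord 0) (psi m c).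
Proof.
apply/Tagged_pncp_inj/pncp_tagged_eq => //=.
  apply/fsetP => A; apply/idP/comp_blocksP => [Am|[] [B]]; last 2 first.
  - by rewrite inE.
  - rewrite inordK //; case/psi_blocksP => m0 -> ->; rewrite shift_psi.
    exact/psi_blocksP.
  right; case/psi_blocksP: Am => m0 ->; exists [fset x in iota 1 m].
    exact/psi_blocksP.
  by rewrite inordK // shift_psi.
by rewrite /comp_bits inordK //= map_nseq cats0.
Qed.

Lemma chain_of_bdry_step n (x : pncp n) (dx : E n) i m c :
    (i <= n)%N -> (0 < m)%N || c -> (head_bound (rdecomp x) <= i)%N ->
    chain_of dx = bd_list (rdecomp x) ->
  chain_of (bdry_step x dx i m c) = bd_list ((i, m, c) :: rdecomp x).
Proof.
move=> le_in hmc hb hdx; rewrite /= degree_rdecomp -hdx.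
have hs : supp (in_level i n) (chain_of dx).
  rewrite hdx; have := supp_level_le hb (supp_bd_list (rdecomp_rightmost x)).
  by rewrite degree_rdecomp.
case: n x dx le_in hb hdx hs => [|n] x dx le_in hb hdx hs.
  have i0 : i = 0 by lia.
  subst i; rewrite /= expr0 scale1r.
  have x0 : rdecomp x = [::] by case: (rdecomp x) hb => [|[[]]].
  rewrite x0 in hdx *.
  case: m hmc => [|m] hmc /=.
    move: hmc => /= ->; rewrite gface0 addr0 hdx linearZ /= linearB /=.
    by rewrite !chain_of1 expr1 scaleN1r.
  rewrite add0r linearD linearZ /= !chain_of1 gfaceS /graft !fglift1 /=.
  have E m' c' : rdecomp (psi m' c') =
      if (0 < m')%N || c' then [:: (0, m', c')] else [::].
    have r0 : rdecomp (psi 0 false) = [::] by exact: (@rdecomp_eval [::]).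
    apply: (etrans (congr1 (@rdecomp m') (psi_pcomp m' c'))).
    have := @rdecomp_pcomp 0 (psi 0 false) 0 m' c' (leqnn 0).
    by rewrite r0; apply.
  by rewrite !E.
case: m hmc => [|m] hmc /=.
  rewrite gface0 scaler0 addr0; case: eqP => [->|ni].
    by rewrite ltnn chain_of_castE linearN.
  have lt_in : (i < n.+1)%N by lia.
  by move: hmc; rewrite lt_in => /= ->; rewrite chain_of_compl.
have hc := chain_of_compr_psi m c le_in hb; rewrite /= in hc.
case: eqP => [i_n|ni].
  rewrite i_n in hc *.
  by rewrite ltnn subnn expr0 scale1r add0r chain_of_castE hc.
have lt_in : (i < n.+1)%N by lia.
by rewrite lt_in linearD linearZ /= chain_of_castE hc chain_of_compl.
Qed.

Lemma chain_of_bdry_list l :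
  is_rightmost l -> chain_of (bdry_list l) = bd_list l.
Proof.
elim: l => [_|[[i m] c] l IH /is_rightmost_cons[hi hmc hb hl]].
  by rewrite /= expr0 scale1r linearB /= !chain_of1.
have e := rdecomp_eval hl.
rewrite -[bdry_list _]/(bdry_step (eval l) (bdry_list l) i m c).
by rewrite chain_of_bdry_step ?e ?IH.
Qed.

Lemma chain_of_bdry n (a : E n.+1) : chain_of (bdry a) = bd (chain_of a).
Proof.
apply: (linear_eq (F := @chain_of n \o fglift (fun x : pncp n => bdry_gen x))
  (G := bd \o @chain_of n.+1)) => x.
apply: etrans (esym (congr1 bd (chain_ofS x))).
rewrite /= fglift1 bd1.
elim/pncp_eval_ind: x => l hl.
by rewrite bdry_gen_eval // rdecomp_eval // chain_of_bdry_list.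
Qed.

(** * Levels *)

(** The alternative n <= k comes from the default value of the iterated
    minimum. *)
Lemma bigmin_le (s : seq nat) n k :
  (\big[minn/n]_(a <- s) a <= k)%N = (n <= k)%N || has (leq^~ k) s.
Proof.
elim: s => [|a s IH]; first by rewrite big_nil orbF.
by rewrite big_cons geq_min IH orbCA.
Qed.

Lemma level_leP n (x : pncp n) k :
  reflect (below k x.1 x.2) (level x <= k)%N.
Proof.
have [p0 p1 _ _] := is_ncpP _ _ (ncp_blocks x.1).
rewrite /level geq_max; apply: (iffP andP) => [] [hA hb]; split.
- move=> A Ap; move: hA => /bigmax_leqP_seq/(_ A Ap isT).
  rewrite bigmin_le => /orP[nk|/hasP[a aA ak]]; last by exists a.
  have [a aA] := p0 A Ap; exists a => //.
  have : (0 < a <= n)%N by apply/p1; exists A.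
  by case/andP => _ /leq_trans; apply.
- move=> j kj; case: (ltnP j (size x.2)) => [lt_j|]; last exact: nth_default.
  apply/negP => bj; move/bigmax_leqP/(_ (Ordinal lt_j) bj): hb => /=.
  by rewrite ltnNge kj.
- apply/bigmax_leqP_seq => A Ap _; rewrite bigmin_le.
  have [a aA ak] := hA A Ap; apply/orP; right; apply/hasP.
  by exists a.
- apply/bigmax_leqP => j bj; rewrite ltnNge; apply/negP => kj.
  by rewrite hb in bj.
Qed.

Lemma level_le_head_bound n (x : pncp n) k :
  (level x <= k)%N = (head_bound (rdecomp x) <= k)%N.
Proof.
elim/pncp_eval_ind: x => l hl; rewrite rdecomp_eval //.
apply/level_leP/idP; first exact: below_head_bound.
move=> lk; have [hA hb] := eval_below hl; split=> [A Ap|j kj].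
  by have [a aA ak] := hA A Ap; exists a => //; apply: leq_trans lk.
by apply: hb; apply: leq_trans kj.
Qed.

Lemma sublevelE k n (a : E n) :
  sublevel k a = supp (in_level k n) (chain_of a).
Proof.
rewrite supp_chain_of; case: n a => [|n] a.
  by apply/esym/allP => x.
apply: eq_all => x; rewrite level_le_head_bound /=.
by rewrite rdecomp_rightmost degree_rdecomp eqxx.
Qed.

Lemma chain_of_onto k n (w : chain) : supp (in_level k n) w ->
  exists a : E n, chain_of a = w.
Proof.
move=> /allP hw; rewrite [w]freeg_sumZ big_seq.
apply: (big_ind (fun w : chain => exists a : E n, chain_of a = w)).
- by exists 0; rewrite linear0.
- by move=> _ _ [a <-] [b <-]; exists (a + b); rewrite linearD.
move=> g /hw hg; have [x <-] : exists x : gen n, cell_of x = g.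
  case: g hg => [b|l]; case: n {w hw} => [|n] //=; first by exists b.
  by case/and3P => hl /eqP <- _; exists (eval l); rewrite rdecomp_eval.
by exists (coeff (cell_of x) w *: basis x); rewrite linearZ /= chain_of1.
Qed.

(** * Acyclicity *)

Lemma sublevel_bdry k n (a : E n.+1) : sublevel k a -> sublevel k (bdry a).
Proof. by rewrite !sublevelE chain_of_bdry; apply: supp_bd. Qed.

Lemma bdry_bdry k n (a : E n.+2) : sublevel k a -> bdry (bdry a) = 0.
Proof.
rewrite sublevelE => ha; apply: chain_of_inj.
by rewrite !chain_of_bdry (bd_bd ha) linear0.
Qed.

Lemma bdry_exact k n (a : E n.+1) : sublevel k a -> bdry a = 0 ->
  exists2 b : E n.+2, sublevel k b & bdry b = a.
Proof.
rewrite sublevelE => ha ba0.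
have [|v hv bv] := bd_exact ha; first by rewrite -chain_of_bdry ba0 linear0.
have [b eb] := chain_of_onto hv; exists b; first by rewrite sublevelE eb.
by apply: chain_of_inj; rewrite chain_of_bdry eb.
Qed.

(** The augmentation, extended by 0 to the lists of factors, so that it is
    invariant under graft. *)
Definition chain_aug : chain -> int^o :=
  fglift (fun g : cell => if g is inl _ then 1 else 0).
HB.instance Definition _ := GRing.Linear.on chain_aug.

Lemma chain_aug_graft i m c w : chain_aug (graft i m c w) = chain_aug w.
Proof.
apply: (linear_eq (F := chain_aug \o graft i m c) (G := chain_aug)) => g.
by rewrite /= /chain_aug /graft !fglift1; case: g.
Qed.

Lemma chain_aug_bd_list l : chain_aug (bd_list l) = 0.
Proof.
elim: l => [|[[i m] c] l IH] /=.
  by rewrite linearB /= /chain_aug !fglift1 subrr.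
rewrite linearD linearZ /=.
have -> : chain_aug (gface i m c << inr l : cell >>) = 0.
  case: m => [|m]; first by rewrite gface0 linear0.
  rewrite gfaceS linearD linearZ /= !chain_aug_graft /chain_aug fglift1.
  by rewrite scaler0 addr0.
rewrite scaler0 addr0; case: ifP => _; first by rewrite chain_aug_graft.
by case: eqP => _; rewrite ?linearN ?linear0 /= ?IH ?oppr0.
Qed.

Lemma aug_chain_of (a : E 0) : aug a = chain_aug (chain_of a).
Proof.
apply: (linear_eq (F := fglift (fun=> 1 : int^o))
  (G := chain_aug \o @chain_of 0)) => x.
by rewrite /= fglift1 (@chain_of1 0) /chain_aug fglift1.
Qed.

Lemma aug_bdry (a : E 1) : aug (bdry a) = 0.
Proof.
rewrite aug_chain_of chain_of_bdry.
apply: (linear_eq (F := chain_aug \o bd) (G := \0)) => g.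
rewrite /= /bd fglift1; case: g => [b|l]; first exact: linear0.
exact: chain_aug_bd_list.
Qed.

Lemma bdry_exact0 k (a : E 0) : aug a = 0 ->
  exists2 b : E 1, sublevel k b & bdry b = a.
Proof.
move=> ha; set t := coeff vt a.
have ea : a = coeff vs a *: @basis 0 vs + t *: @basis 0 vt.
  by apply/eqP/freeg_eqP => -[];
    rewrite coeffD !coeffZ !coeffU /= !mulr1 ?mulr0 ?addr0 ?add0r.
have st : coeff vs a = - t.
  apply/eqP; rewrite -addr_eq0 -ha [in X in _ == X]ea aug_chain_of.
  rewrite !linearD !linearZ /= !chain_of1 /chain_aug !fglift1.
  by rewrite -[(_ *: _ : int^o)]/(_ * _) -[(t *: _ : int^o)]/(_ * _) !mulr1.
have hw : supp (in_level k 1) (t *: << inr [::] : cell >>).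
  by rewrite suppZ // suppU.
have [b eb] := chain_of_onto hw; exists b; first by rewrite sublevelE eb.
apply: chain_of_inj; rewrite chain_of_bdry eb linearZ /= bd1 /= ea st.
rewrite [RHS]linearD [X in _ = X + _]linearZ [X in _ = _ + X]linearZ /=.
by rewrite !chain_of1 scalerBr scaleNr addrC.
Qed.

Lemma sublevel_exhaust n (a : E n) : exists k, sublevel k a.
Proof.
case: n a => [|n] a; first by exists 0.
exists (\max_(x <- dom a) level (x : pncp n))%N; apply/allP => x xa.
exact: (leq_bigmax_seq (F := fun x : pncp n => level x)).
Qed.

Theorem theorem2p13 :
  (forall k : nat, acyclic bdry aug (sublevel k)) /\
  acyclic bdry aug (fun n => predT).
Proof.
have aug_onto (z : int) : aug (z *: @basis 0 vs) = z.
  rewrite aug_chain_of !linearZ /= chain_of1 /chain_aug fglift1.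
  exact: mulr1.
split=> [k|]; split.
- by move=> z; exists (z *: @basis 0 vs).
- move=> x; split=> [[_ /(bdry_exact0 k)//]|[y _ <-]].
  by split=> //; apply: aug_bdry.
- move=> n x; split=> [[hx /(bdry_exact hx)//]|[y hy <-]].
  by split; [apply: sublevel_bdry | apply: bdry_bdry hy].
- by move=> z; exists (z *: @basis 0 vs).
- move=> x; split=> [[_ /(bdry_exact0 0)[y _ <-]]|[y _ <-]]; first by exists y.
  by split=> //; apply: aug_bdry.
- move=> n x; split=> [[_ dx]|[y _ <-]].
    have [k hx] := sublevel_exhaust x.
    by have [y _ <-] := bdry_exact hx dx; exists y.
  by have [k hy] := sublevel_exhaust y; split=> //; apply: bdry_bdry hy.
Qed.
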